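(* For every integer $p\ge 3$ there exist $q\ge1$, a rational polytope $P\subseteq\mathbb{R}^{p+q}$ with $P_I\neq\emptyset$ and a rational objective function $cx+hy$ such that, with $\gamma^*=\max\{cx+hy:(x,y)\in P_I\}$, $$\sup\{cx+hy:(x,y)\in P^{(n)}_{2^{p-1}+1}\}>\gamma^*\quad\text{for all } n\in\mathbb{N}.$$ That is, in general $(2^{p-1}+1)$-disjunctive cuts do not suffice to solve a mixed integer program in finitely many rounds.
   Context: $P_I=\mathrm{conv}\{(x,y)\in P:x\in\mathbb{Z}^p\}$. A $k$-disjunction ($k\ge 2$) is a family of inequalities $d^1x\le\delta^1,\dots,d^kx\le\delta^k$ with $d^i\in\mathbb{Z}^p$ (not necessarily distinct), $\delta^i\in\mathbb{Z}$, such that every $x\in\mathbb{Z}^p$ satisfies $d^ix\le\delta^i$ for some $i$. For a closed convex set $C\subseteq\mathbb{R}^{p+q}$, an inequality $\alpha x+\beta y\le\gamma$ is a $k$-disjunctive cut for $C$ if it is not valid for $C$ and there is a $k$-disjunction such that every $(x,y)\in C$ with $\alpha x+\beta y>\gamma$ satisfies $d^ix>\delta^i$ for all $i$. The $k$-disjunctive closure of $C$ is the intersection of $C$ with all half-spaces given by $k$-disjunctive cuts for $C$; $P^{(0)}_k=P$ and $P^{(n)}_k$ is the $k$-disjunctive closure of $P^{(n-1)}_k$. *)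

(* Defs.v *)
From Stdlib Require Import Reals ZArith Arith.
Open Scope R_scope.

(* Points of R^N are represented as functions nat -> R that vanish at all
   coordinates >= N.  A point z of R^(p+q) is (x,y) with x = (z 0,...,z (p-1))
   and y = (z p, ..., z (p+q-1)). *)

Fixpoint rsum (n : nat) (f : nat -> R) : R :=
  match n with
  | O => 0
  | S m => rsum m f + f m
  end.

Definition dot (n : nat) (a z : nat -> R) : R := rsum n (fun i => a i * z i).

Definition supported (N : nat) (z : nat -> R) : Prop :=
  forall i, (N <= i)%nat -> z i = 0.

Definition is_int (r : R) : Prop := exists k : Z, r = IZR k.

Definition is_rat (r : R) : Prop :=
  exists a b : Z, (b <> 0)%Z /\ r = IZR a / IZR b.

Definition rational_polytope (N : nat) (P : (nat -> R) -> Prop) : Prop :=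
  exists (m : nat) (A : nat -> nat -> R) (b : nat -> R),
    (forall i j, is_rat (A i j)) /\ (forall i, is_rat (b i)) /\
    (forall z, P z <-> (supported N z /\
                        forall i, (i < m)%nat -> dot N (A i) z <= b i)) /\
    (exists M : R, forall z, P z -> forall j, Rabs (z j) <= M).

Definition conv (S : (nat -> R) -> Prop) (z : nat -> R) : Prop :=
  exists (k : nat) (lam : nat -> R) (pts : nat -> nat -> R),
    (forall i, (i < k)%nat -> 0 <= lam i /\ S (pts i)) /\
    rsum k lam = 1 /\
    (forall j, z j = rsum k (fun i => lam i * pts i j)).

Definition integer_hull (p : nat) (P : (nat -> R) -> Prop) : (nat -> R) -> Prop :=
  conv (fun z => P z /\ forall j, (j < p)%nat -> is_int (z j)).

Definition k_disjunction (p k : nat) (d : nat -> nat -> R) (delta : nat -> R)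
  : Prop :=
  (2 <= k)%nat /\
  (forall i j, (i < k)%nat -> (j < p)%nat -> is_int (d i j)) /\
  (forall i, (i < k)%nat -> is_int (delta i)) /\
  (forall x : nat -> R, (forall j, (j < p)%nat -> is_int (x j)) ->
     exists i, (i < k)%nat /\ dot p (d i) x <= delta i).

(* alpha x + beta y <= gamma (alpha,beta packed into one vector a of R^N)
   is a k-disjunctive cut for C subset of R^N (first p coordinates integer) *)
Definition k_disj_cut (N p k : nat) (C : (nat -> R) -> Prop)
  (a : nat -> R) (gamma : R) : Prop :=
  (exists z, C z /\ dot N a z > gamma) /\
  exists (d : nat -> nat -> R) (delta : nat -> R),
    k_disjunction p k d delta /\
    forall z, C z -> dot N a z > gamma ->
      forall i, (i < k)%nat -> dot p (d i) z > delta i.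

Definition k_disj_closure (N p k : nat) (C : (nat -> R) -> Prop)
  : (nat -> R) -> Prop :=
  fun z => C z /\ forall a gamma, k_disj_cut N p k C a gamma -> dot N a z <= gamma.

Fixpoint k_disj_iter (N p k : nat) (P : (nat -> R) -> Prop) (n : nat)
  : (nat -> R) -> Prop :=
  match n with
  | O => P
  | S m => k_disj_closure N p k (k_disj_iter N p k P m)
  end.

(* Main.v *)
(** Let [m = p - 1], choose dyadic weights [w_j > 0] of sum 1 with [1 / (2 w_j)]
    integral, and let [P] be the set of all [(x, s, y)] with [0 <= y],
    [y <= s <= 2 - y] and [sum_j w_j |2 x_j - s| + y <= 1].  It is a pyramid over
    a lattice polytope [K] without interior lattice points, so [y = 0] on [P_I].
    The [2^m + 2] lattice points [(eps, 1)] with [eps] in [{0,1}^m], [(0, 0)] and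
    [(1, 2)] lie in the interiors of different facets of [K], hence the midpoint
    of any two of them is interior to [K].

    An affine function that is nonnegative on the lattice points of [K] has
    comparable values at any two points well inside [K].  Hence a cut that
    lowers the height of one such point far enough cuts off all the midpoints at
    their present height.  By the pigeonhole principle, two of the [2^m + 2]
    lattice points satisfy the same one of the [2^m + 1] inequalities of the
    disjunction; so does their midpoint, which therefore cannot be cut off.
    Hence each round keeps a fixed fraction of the height. *)

Require Import Defs.
From Stdlib Require Import Reals ZArith Arith Classical Lra Lia.
Open Scope R_scope.

(** * Finite sums *)

Lemma rsum_ext n f g :
  (forall i, (i < n)%nat -> f i = g i) -> rsum n f = rsum n g.
Proof.
  induction n as [|n IH]; intros H; simpl; [reflexivity|].
  rewrite IH, H; auto.
Qed.

Lemma rsum_le n f g :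
  (forall i, (i < n)%nat -> f i <= g i) -> rsum n f <= rsum n g.
Proof.
  induction n as [|n IH]; intros H; simpl; [lra|].
  apply Rplus_le_compat; auto.
Qed.

Lemma rsum_0 n : rsum n (fun _ => 0) = 0.
Proof. induction n as [|n IH]; simpl; [|rewrite IH]; lra. Qed.

Lemma rsum_lin n a b f g :
  rsum n (fun i => a * f i + b * g i) = a * rsum n f + b * rsum n g.
Proof. induction n as [|n IH]; simpl; [|rewrite IH]; lra. Qed.

Lemma rsum_scal n a f : rsum n (fun i => a * f i) = a * rsum n f.
Proof. induction n as [|n IH]; simpl; [|rewrite IH]; lra. Qed.

Lemma rsum_abs n f : Rabs (rsum n f) <= rsum n (fun i => Rabs (f i)).
Proof.
  induction n as [|n IH]; simpl; [rewrite Rabs_R0; lra|].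
  eapply Rle_trans; [apply Rabs_triang|lra].
Qed.

Lemma rsum_add_at n j c f :
  (j < n)%nat ->
  rsum n (fun i => f i + (if i =? j then c else 0)) = rsum n f + c.
Proof.
  induction n as [|n IH]; intros H; [lia|]; simpl.
  destruct (Nat.eq_dec j n) as [ ->|Hj].
  - rewrite Nat.eqb_refl, (rsum_ext n _ f); [lra|].
    intros i Hi. rewrite (proj2 (Nat.eqb_neq i n)) by lia. lra.
  - rewrite IH by lia. rewrite (proj2 (Nat.eqb_neq n j)) by lia. lra.
Qed.

Lemma rsum_le_gap n j c f g :
  (j < n)%nat -> (forall i, (i < n)%nat -> f i <= g i) -> f j + c <= g j ->
  rsum n f + c <= rsum n g.
Proof.
  intros Hj H Hc. rewrite <- (rsum_add_at n j c f Hj).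
  apply rsum_le; intros i Hi.
  destruct (Nat.eqb_spec i j) as [ ->|]; [assumption|].
  specialize (H i Hi); lra.
Qed.

Lemma rsum_ge_term n j f :
  (j < n)%nat -> (forall i, (i < n)%nat -> 0 <= f i) -> f j <= rsum n f.
Proof.
  intros Hj H.
  pose proof (rsum_le_gap n j (f j) (fun _ => 0) f Hj H) as H1.
  rewrite rsum_0 in H1. lra.
Qed.

(** * Rational numbers *)

Lemma is_rat_IZR k : is_rat (IZR k).
Proof. exists k, 1%Z. split; [lia|field]. Qed.

Lemma is_rat_plus x y : is_rat x -> is_rat y -> is_rat (x + y).
Proof.
  intros (a & b & Hb & ->) (c & d & Hd & ->).
  exists (a * d + c * b)%Z, (b * d)%Z. split; [lia|].
  rewrite plus_IZR, !mult_IZR. field.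
  split; now apply not_0_IZR.
Qed.

Lemma is_rat_mult x y : is_rat x -> is_rat y -> is_rat (x * y).
Proof.
  intros (a & b & Hb & ->) (c & d & Hd & ->).
  exists (a * c)%Z, (b * d)%Z. split; [lia|].
  rewrite !mult_IZR. field.
  split; now apply not_0_IZR.
Qed.

Lemma is_rat_half_pow n : is_rat ((/2) ^ n).
Proof.
  induction n as [|n IH]; simpl; [apply (is_rat_IZR 1)|].
  apply is_rat_mult; [exists 1%Z, 2%Z; split; [lia|lra]|assumption].
Qed.

Lemma is_rat_rsum n f : (forall i, is_rat (f i)) -> is_rat (rsum n f).
Proof.
  intros H; induction n as [|n IH]; simpl; [apply (is_rat_IZR 0)|].
  now apply is_rat_plus.
Qed.

Lemma is_int_INR n : is_int (INR n).
Proof. exists (Z.of_nat n). apply INR_IZR_INZ. Qed.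

Lemma is_int_plus x y : is_int x -> is_int y -> is_int (x + y).
Proof. intros [a ->] [b ->]. exists (a + b)%Z. now rewrite plus_IZR. Qed.

Lemma is_int_opp x : is_int x -> is_int (- x).
Proof. intros [a ->]. exists (- a)%Z. now rewrite opp_IZR. Qed.

(** * Binary digits and the pigeonhole principle *)

(** The bits of numbers below [2 ^ m] encode {0,1}^m; they index both the sign vectors and the
    lattice points (eps, 1). *)
Lemma exists_testbit m (f : nat -> bool) :
  exists i, (i < 2 ^ m)%nat /\ forall j, (j < m)%nat -> Nat.testbit i j = f j.
Proof.
  revert f; induction m as [|m IH]; intros f.
  - exists 0%nat. simpl. split; [lia|intros; lia].
  - destruct (IH (fun j => f (S j))) as (i & Hi & H).
    exists (2 * i + Nat.b2n (f 0%nat))%nat. split.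
    + destruct (f 0%nat); simpl in *; lia.
    + intros [|j] Hj; [apply Nat.testbit_0_r|].
      rewrite Nat.testbit_succ_r. apply H; lia.
Qed.

Lemma testbit_neq m u v :
  (u < 2 ^ m)%nat -> (v < 2 ^ m)%nat -> u <> v ->
  exists j, (j < m)%nat /\ Nat.testbit u j <> Nat.testbit v j.
Proof.
  intros Hu Hv Huv. apply NNPP; intros Hn. apply Huv.
  apply Nat.bits_inj; intros j.
  destruct (Nat.lt_ge_cases j m) as [Hj|Hj].
  - apply NNPP; intros Hj'. apply Hn. now exists j.
  - rewrite <- (Nat.mod_small u (2 ^ m)), <- (Nat.mod_small v (2 ^ m)) by assumption.
    now rewrite !Nat.mod_pow2_bits_high.
Qed.

Lemma pigeonhole K (Q : nat -> nat -> Prop) :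
  (forall v, (v < S K)%nat -> exists i, (i < K)%nat /\ Q v i) ->
  exists u v i, (u < v)%nat /\ (v < S K)%nat /\ (i < K)%nat /\ Q u i /\ Q v i.
Proof.
  revert Q; induction K as [|K IH]; intros Q H.
  - destruct (H 0%nat) as (i & Hi & _); lia.
  - destruct (H (S K)) as (i0 & Hi0 & Q0); [lia|].
    destruct (classic (exists u, (u < S K)%nat /\ Q u i0)) as [(u & Hu & Qu)|Hn].
    { exists u, (S K), i0. repeat split; auto; lia. }
    (* No other pigeon fits the hole [i0] of the last one, so the remaining holes are renumbered by
       skipping [i0]. *)
    destruct (IH (fun v i => Q v (if i <? i0 then i else S i))) as (u & v & i & Hu & Hv & Hi & Qu & Qv).
    { intros v Hv. destruct (H v) as (i & Hi & Qi); [lia|].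
      assert (i <> i0) by (intros ->; apply Hn; now exists v).
      destruct (Nat.lt_ge_cases i i0) as [Hlt|Hge].
      - exists i. split; [lia|]. now rewrite (proj2 (Nat.ltb_lt i i0)).
      - exists (pred i). split; [lia|].
        rewrite (proj2 (Nat.ltb_ge (pred i) i0)) by lia.
        now replace (S (pred i)) with i by lia. }
    exists u, v, (if i <? i0 then i else S i).
    repeat split; auto; destruct (i <? i0); lia.
Qed.

(** * The polytope *)

(* Listed from [j = 0], the weights are 2^(1-m), 2^(1-m), 2^(2-m), ..., 1/4, 1/2. *)
Definition wt (m j : nat) : R := (/2) ^ (m - 1 - pred j).

Lemma half_pow_pos n : 0 < (/2) ^ n.
Proof. apply pow_lt; lra. Qed.

Lemma half_pow_le a b : (a <= b)%nat -> (/2) ^ b <= (/2) ^ a.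
Proof.
  intros H. induction H as [|b H IH]; simpl; [lra|].
  pose proof (half_pow_pos b). lra.
Qed.

Lemma wt_pos m j : 0 < wt m j.
Proof. apply half_pow_pos. Qed.

Lemma wt_ge m j : (/2) ^ m <= wt m j.
Proof. apply half_pow_le; lia. Qed.

Lemma wt_sum m : (1 <= m)%nat -> rsum m (wt m) = 1.
Proof.
  intros Hm.
  (* Each weight from the second on equals the sum of its predecessors, so the partial sums double
     until they reach 1. *)
  assert (H : forall j, (j < m)%nat -> rsum (S j) (wt m) = (/2) ^ (m - 1 - j)).
  { induction j as [|j IH]; intros Hj.
    - simpl. unfold wt. simpl. lra.
    - change (rsum (S j) (wt m) + wt m (S j) = (/2) ^ (m - 1 - S j)).
      rewrite IH by lia. unfold wt. simpl pred.
      replace (m - 1 - j)%nat with (S (m - 1 - S j)) by lia. simpl. lra. }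
  specialize (H (pred m)). replace (S (pred m)) with m in H by lia.
  rewrite H by lia. now replace (m - 1 - pred m)%nat with 0%nat by lia.
Qed.

(** Makes the vertices of the bottom and top facets integral. Here [2 <= m] matters: for [m = 1] the
    only weight is 1, and 1 / 2 is not an integer. *)
Lemma wt_inv_int m j :
  (2 <= m)%nat -> (j < m)%nat -> exists N, is_int N /\ 2 * wt m j * N = 1.
Proof.
  intros Hm Hj. exists (2 ^ (m - 2 - pred j)). split.
  - exists (2 ^ Z.of_nat (m - 2 - pred j))%Z. apply pow_IZR.
  - unfold wt. replace (m - 1 - pred j)%nat with (S (m - 2 - pred j)) by lia.
    simpl. replace (2 * (/ 2 * (/2) ^ (m - 2 - pred j))) with ((/2) ^ (m - 2 - pred j)) by lra.
    rewrite <- Rpow_mult_distr, Rinv_l by lra. apply pow1.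
Qed.

(** The height [t] is separate from [z (S m)]: how deep a base point lies inside K is measured
    independently of the height at which it is kept. *)
Definition below (m : nat) (z : nat -> R) (t : R) : Prop :=
  t <= z m /\ t <= 2 - z m /\
  rsum m (fun j => wt m j * Rabs (2 * z j - z m)) + t <= 1.

Definition pyramid (m : nat) (z : nat -> R) : Prop :=
  supported (S (S m)) z /\ 0 <= z (S m) /\ below m z (z (S m)).

Definition sgn (i j : nat) : R := if Nat.testbit i j then 1 else -1.

(** A weighted l1 norm is the maximum of 2^m linear forms, one for each sign vector; this turns
    [below] into linear inequalities. *)
Lemma abs_sum_signs m z t :
  rsum m (fun j => wt m j * Rabs (2 * z j - z m)) + t <= 1 <->
  forall i, (i < 2 ^ m)%nat ->
    rsum m (fun j => sgn i j * wt m j * (2 * z j - z m)) + t <= 1.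
Proof.
  split.
  - intros H i _. eapply Rle_trans; [|exact H].
    apply Rplus_le_compat_r, rsum_le. intros j _.
    pose proof (wt_pos m j). unfold sgn.
    destruct (Nat.testbit i j); unfold Rabs; destruct Rcase_abs; nra.
  - intros H.
    destruct (exists_testbit m (fun j => if Rle_dec 0 (2 * z j - z m) then true else false))
      as (i & Hi & Hb).
    eapply Rle_trans; [|exact (H i Hi)].
    apply Rplus_le_compat_r, rsum_le. intros j Hj.
    unfold sgn. rewrite Hb by assumption.
    destruct Rle_dec; [rewrite Rabs_right by lra|rewrite Rabs_left by lra]; lra.
Qed.

(** After the sign rows come y <= s, s + y <= 2 and 0 <= y. Rationality is demanded at all indices,
    so the last branches also cover those out of range. *)
Definition row (m i j : nat) : R :=
  if i <? 2 ^ m then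
    if j <? m then 2 * (sgn i j * wt m j)
    else if j =? m then -1 * rsum m (fun l => sgn i l * wt m l)
    else 1
  else match (i - 2 ^ m)%nat with
  | 0%nat => if j <? m then 0 else if j =? m then -1 else 1
  | 1%nat => if j <? m then 0 else 1
  | _ => if j <? m then 0 else if j =? m then 0 else -1
  end.

Definition rhs (m i : nat) : R :=
  if i <? 2 ^ m then 1
  else match (i - 2 ^ m)%nat with
  | 0%nat => 0
  | 1%nat => 2
  | _ => 0
  end.

Lemma row_tail m r j :
  row m (2 ^ m + r) j =
  match r with
  | 0%nat => if j <? m then 0 else if j =? m then -1 else 1
  | 1%nat => if j <? m then 0 else 1
  | _ => if j <? m then 0 else if j =? m then 0 else -1
  end.
Proof.
  unfold row. rewrite (proj2 (Nat.ltb_ge (2 ^ m + r) (2 ^ m))) by lia.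
  now replace (2 ^ m + r - 2 ^ m)%nat with r by lia.
Qed.

Lemma rhs_tail m r :
  rhs m (2 ^ m + r) = match r with 0%nat => 0 | 1%nat => 2 | _ => 0 end.
Proof.
  unfold rhs. rewrite (proj2 (Nat.ltb_ge (2 ^ m + r) (2 ^ m))) by lia.
  now replace (2 ^ m + r - 2 ^ m)%nat with r by lia.
Qed.

Lemma dot_split m a z :
  dot (S (S m)) a z = dot m a z + a m * z m + a (S m) * z (S m).
Proof. reflexivity. Qed.

Lemma row_last m i c d e (z : nat -> R) :
  (forall j, row m i j = if j <? m then c j else if j =? m then d else e) ->
  dot (S (S m)) (row m i) z = rsum m (fun j => c j * z j) + d * z m + e * z (S m).
Proof.
  intros H. rewrite dot_split. unfold dot.
  rewrite (rsum_ext m _ (fun j => c j * z j)).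
  - rewrite !H, Nat.ltb_irrefl, Nat.eqb_refl.
    rewrite (proj2 (Nat.ltb_ge (S m) m)) by lia.
    now rewrite (proj2 (Nat.eqb_neq (S m) m)) by lia.
  - intros j Hj. now rewrite H, (proj2 (Nat.ltb_lt j m)).
Qed.

Lemma dot_row_sign m i z :
  (i < 2 ^ m)%nat ->
  dot (S (S m)) (row m i) z =
  rsum m (fun j => sgn i j * wt m j * (2 * z j - z m)) + z (S m).
Proof.
  intros Hi.
  rewrite (row_last m i (fun j => 2 * (sgn i j * wt m j))
             (-1 * rsum m (fun l => sgn i l * wt m l)) 1).
  - rewrite (rsum_ext m (fun j => sgn i j * wt m j * (2 * z j - z m))
      (fun j => 1 * (2 * (sgn i j * wt m j) * z j) + - z m * (sgn i j * wt m j)))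
      by (intros; ring).
    rewrite rsum_lin. ring.
  - intros j. unfold row. now rewrite (proj2 (Nat.ltb_lt i _)).
Qed.

Lemma pyramid_rows m z :
  pyramid m z <->
  supported (S (S m)) z /\
  forall i, (i < 2 ^ m + 3)%nat -> dot (S (S m)) (row m i) z <= rhs m i.
Proof.
  assert (Hrow : forall r d e b,
    (forall j, row m (2 ^ m + r) j = if j <? m then 0 else if j =? m then d else e) ->
    rhs m (2 ^ m + r) = b ->
    (dot (S (S m)) (row m (2 ^ m + r)) z <= rhs m (2 ^ m + r) <->
     d * z m + e * z (S m) <= b)).
  { intros r d e b H ->. rewrite (row_last m _ (fun _ => 0) d e z H).
    rewrite (rsum_ext m _ (fun _ => 0)) by (intros; lra). rewrite rsum_0.
    split; intros; lra. }
  assert (H0 := Hrow 0%nat (-1) 1 0 (row_tail m 0) (rhs_tail m 0)).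
  assert (H1 : dot (S (S m)) (row m (2 ^ m + 1)) z <= rhs m (2 ^ m + 1) <->
               1 * z m + 1 * z (S m) <= 2).
  { apply Hrow; [|apply rhs_tail]. intros j. rewrite row_tail.
    now destruct (j <? m), (j =? m). }
  assert (H2 := Hrow 2%nat 0 (-1) 0 (row_tail m 2) (rhs_tail m 2)).
  assert (Hs : forall i, (i < 2 ^ m)%nat -> rhs m i = 1).
  { intros i Hi. unfold rhs. now rewrite (proj2 (Nat.ltb_lt i _)). }
  unfold pyramid, below. rewrite abs_sum_signs. split.
  - intros (Hz & Hy & Ha & Hb & Hc). split; [assumption|]. intros i Hi.
    destruct (Nat.lt_ge_cases i (2 ^ m)) as [Hlt|Hge].
    + rewrite dot_row_sign, Hs by assumption. now apply Hc.
    + assert (Hi' : i = (2 ^ m + 0)%nat \/ i = (2 ^ m + 1)%nat \/ i = (2 ^ m + 2)%nat) by lia.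
      destruct Hi' as [ ->|[ ->| ->]]; [apply H0|apply H1|apply H2]; lra.
  - intros (Hz & H).
    assert (K0 := proj1 H0 (H (2 ^ m + 0)%nat ltac:(lia))).
    assert (K1 := proj1 H1 (H (2 ^ m + 1)%nat ltac:(lia))).
    assert (K2 := proj1 H2 (H (2 ^ m + 2)%nat ltac:(lia))).
    repeat split; try assumption; try lra.
    intros i Hi. specialize (H i ltac:(lia)).
    now rewrite dot_row_sign, Hs in H by assumption.
Qed.

Lemma is_rat_sgn i j : is_rat (sgn i j).
Proof. unfold sgn. destruct Nat.testbit; [apply (is_rat_IZR 1)|apply (is_rat_IZR (-1))]. Qed.

Lemma pyramid_rational m : rational_polytope (S (S m)) (pyramid m).
Proof.
  assert (Hw : forall i j, is_rat (sgn i j * wt m j)).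
  { intros. apply is_rat_mult; [apply is_rat_sgn|apply is_rat_half_pow]. }
  exists (2 ^ m + 3)%nat, (row m), (rhs m). split; [|split; [|split]].
  - intros i j. unfold row.
    destruct (i <? 2 ^ m);
      [|destruct (i - 2 ^ m)%nat as [|[| ]]]; destruct (j <? m), (j =? m);
      try (apply is_rat_IZR);
      apply is_rat_mult; auto using is_rat_IZR, is_rat_rsum.
  - intros i. unfold rhs.
    destruct (i <? 2 ^ m); [|destruct (i - 2 ^ m)%nat as [|[| ]]]; apply is_rat_IZR.
  - apply pyramid_rows.
  (* A single term of the sum gives |2 x_j - s| <= 1 / w_j <= 2^m, and 0 <= s <= 2. *)
  - exists (2 + 2 ^ m). intros z (Hz & Hy & Ha & Hb & Hc) j.
    assert (H1 : 1 <= 2 ^ m) by (apply pow_R1_Rle; lra).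
    destruct (Nat.lt_ge_cases j m) as [Hj|Hj].
    + assert (Hp := rsum_ge_term m j (fun j => wt m j * Rabs (2 * z j - z m)) Hj
        (fun i _ => Rmult_le_pos _ _ (Rlt_le _ _ (wt_pos m i)) (Rabs_pos _))).
      simpl in Hp.
      assert (Hm : (/2) ^ m * 2 ^ m = 1).
      { rewrite <- Rpow_mult_distr, Rinv_l by lra. apply pow1. }
      pose proof (wt_ge m j). pose proof (half_pow_pos m).
      assert (Hr : Rabs (2 * z j - z m) <= 2 ^ m).
      { pose proof (Rabs_pos (2 * z j - z m)). nra. }
      revert Hr. unfold Rabs. do 2 destruct Rcase_abs; lra.
    + destruct (Nat.eq_dec j m) as [ ->|]; [rewrite Rabs_right; lra|].
      destruct (Nat.eq_dec j (S m)) as [ ->|]; [rewrite Rabs_right; lra|].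
      rewrite Hz, Rabs_R0 by lia. lra.
Qed.

(** For s = 0 or s = 2 the bounds y <= s <= 2 - y force y <= 0. For s = 1 every 2 x_j - 1 is odd, so
    the weighted sum is already at least 1. *)
Lemma pyramid_int_height m z :
  (1 <= m)%nat -> pyramid m z -> (forall j, (j < S m)%nat -> is_int (z j)) -> z (S m) <= 0.
Proof.
  intros Hm (_ & Hy & Ha & Hb & Hc) Hint.
  destruct (Hint m) as [k Hk]; [lia|].
  assert (0 <= k <= 2)%Z by (split; apply le_IZR; lra).
  assert (Hk' : k = 0%Z \/ k = 1%Z \/ k = 2%Z) by lia.
  destruct Hk' as [ ->|[ ->| ->]]; try lra.
  assert (1 <= rsum m (fun j => wt m j * Rabs (2 * z j - z m))); [|lra].
  rewrite <- (wt_sum m Hm). apply rsum_le. intros j Hj.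
  destruct (Hint j) as [l Hl]; [lia|]. rewrite Hl, Hk.
  rewrite <- mult_IZR, <- minus_IZR, <- abs_IZR.
  assert (1 <= IZR (Z.abs (2 * l - 1))) by (apply IZR_le; lia).
  pose proof (wt_pos m j). nra.
Qed.

(** * Affine functions that are nonnegative on the lattice points *)

(* For [c = 1 / (2 w_j)] or its opposite, a vertex of the bottom facet ([b = 0])
   or of the top facet ([b = 1]) of [K]; the last coordinates are [(s, y) = (2b, 0)]. *)
Definition corner (m j : nat) (b c : R) (l : nat) : R :=
  (if l <? m then b else if l =? m then 2 * b else 0) + (if l =? j then c else 0).

Lemma corner_lt m j b c l : (l < m)%nat -> corner m j b c l = b + (if l =? j then c else 0).
Proof. intros H. unfold corner. now rewrite (proj2 (Nat.ltb_lt l m)). Qed.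

Lemma corner_m m j b c : (j < m)%nat -> corner m j b c m = 2 * b.
Proof.
  intros H. unfold corner. rewrite Nat.ltb_irrefl, Nat.eqb_refl.
  rewrite (proj2 (Nat.eqb_neq m j)) by lia. lra.
Qed.

Lemma corner_gt m j b c l : (j < m)%nat -> (m < l)%nat -> corner m j b c l = 0.
Proof.
  intros H Hl. unfold corner. rewrite (proj2 (Nat.ltb_ge l m)) by lia.
  rewrite (proj2 (Nat.eqb_neq l j)), (proj2 (Nat.eqb_neq l m)) by lia. lra.
Qed.

Lemma corner_pyramid m j b c :
  (j < m)%nat -> 0 <= b <= 1 -> 2 * wt m j * Rabs c <= 1 -> pyramid m (corner m j b c).
Proof.
  intros Hj Hb Hc. unfold pyramid, below.
  rewrite corner_m, (corner_gt m j b c (S m)) by lia.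
  split; [intros l Hl; apply corner_gt; lia|].
  repeat split; try lra.
  rewrite (rsum_ext m _ (fun l => 0 + if l =? j then 2 * wt m j * Rabs c else 0)).
  - rewrite rsum_add_at, rsum_0 by assumption. lra.
  - intros l Hl. rewrite corner_lt by assumption.
    destruct (Nat.eqb_spec l j) as [ ->|].
    + replace (2 * (b + c) - 2 * b) with (2 * c) by ring.
      rewrite Rabs_mult, (Rabs_right 2) by lra. ring.
    + replace (2 * (b + 0) - 2 * b) with 0 by ring. rewrite Rabs_R0. ring.
Qed.

Lemma dot_corner m j a b c :
  (j < m)%nat ->
  dot (S m) a (corner m j b c) = b * (rsum m a + 2 * a m) + a j * c.
Proof.
  intros Hj. unfold dot. simpl. rewrite corner_m by assumption.
  rewrite (rsum_ext m _ (fun l => b * a l + if l =? j then a j * c else 0)).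
  - rewrite rsum_add_at, rsum_scal by assumption. ring.
  - intros l Hl. rewrite corner_lt by assumption.
    destruct (Nat.eqb_spec l j) as [ ->|]; ring.
Qed.

Section NonnegativeAffine.

Variables (m : nat) (a : nat -> R) (gamma : R).
Hypothesis m_ge2 : (2 <= m)%nat.
Hypothesis valid : forall z, pyramid m z -> (forall j, (j < S m)%nat -> is_int (z j)) ->
  z (S m) = 0 -> dot (S m) a z <= gamma.

(** With N = 1 / (2 w_j), adding N or -N to coordinate j of (b, ..., b, 2b) gives two lattice points
    of K. Validity at both bounds |a_j| N by the slack at their midpoint, the center of the bottom
    or top facet. *)
Lemma slope_bound j b :
  (j < m)%nat -> b = 0 \/ b = 1 ->
  Rabs (a j) <= 2 * wt m j * (gamma - b * (rsum m a + 2 * a m)).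
Proof.
  intros Hj Hb. destruct (wt_inv_int m j m_ge2 Hj) as (N & HN & HwN).
  pose proof (wt_pos m j) as Hw.
  assert (HN0 : 0 < N) by nra.
  assert (Hbi : is_int b) by (destruct Hb as [ ->| ->]; [apply (is_int_INR 0)|apply (is_int_INR 1)]).
  assert (H : forall c, is_int c -> Rabs c = N ->
    b * (rsum m a + 2 * a m) + a j * c <= gamma).
  { intros c Hc Habs. rewrite <- dot_corner by assumption. apply valid.
    - apply corner_pyramid; [assumption|destruct Hb; lra|rewrite Habs; lra].
    - intros l Hl. unfold corner. apply is_int_plus.
      + destruct (l <? m); [assumption|]. destruct (l =? m); [|apply (is_int_INR 0)].
        replace (2 * b) with (b + b) by ring. now apply is_int_plus.
      + destruct (l =? j); [assumption|apply (is_int_INR 0)].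
    - apply corner_gt; lia. }
  pose proof (H N HN (Rabs_right N ltac:(lra))) as H1.
  pose proof (H (- N) (is_int_opp N HN) ltac:(rewrite Rabs_Ropp, Rabs_right; lra)) as H2.
  set (A := gamma - b * (rsum m a + 2 * a m)) in *.
  assert (K1 : a j * N <= A) by (unfold A; lra).
  assert (K2 : - (a j * N) <= A) by (unfold A; lra).
  replace (a j) with (2 * wt m j * (a j * N))
    by (transitivity ((2 * wt m j * N) * a j); [ring|rewrite HwN; ring]).
  rewrite Rabs_mult, (Rabs_right (2 * wt m j)) by lra.
  apply Rmult_le_compat_l; [lra|]. now apply Rabs_le; lra.
Qed.

(** The slack at the center (1/2, ..., 1/2, 1) of K, which is the mean of the slacks at the centers
    of the bottom and top facets. *)
Definition center_value : R := gamma - rsum m a / 2 - a m.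

(** Let C be [center_value], and C + D, C - D the slacks at the bottom and top centers. The slack at
    z is C - (s - 1) D - X, where |s - 1| <= 1 - t and, by [slope_bound], |X| <= (C - |D|) (1 - t).
    So it differs from C by at most (1 - t) C. *)
Lemma slack_bounds z t :
  0 <= t -> below m z t ->
  t * center_value <= gamma - dot (S m) a z <= 2 * center_value /\ 0 <= center_value.
Proof.
  intros Ht (Hs1 & Hs2 & Hs).
  (* The effect of displacing x from the axis x_j = s / 2. *)
  set (X := rsum m (fun j => a j / 2 * (2 * z j - z m))).
  assert (HX : forall b, b = 0 \/ b = 1 ->
    0 <= gamma - b * (rsum m a + 2 * a m) /\
    Rabs X <= (gamma - b * (rsum m a + 2 * a m)) * (1 - t)).
  { intros b Hb.
    assert (Hp : 0 <= gamma - b * (rsum m a + 2 * a m)).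
    { pose proof (slope_bound 0 b ltac:(lia) Hb).
      pose proof (Rabs_pos (a 0%nat)). pose proof (wt_pos m 0). nra. }
    split; [assumption|].
    eapply Rle_trans; [apply rsum_abs|].
    eapply Rle_trans; [|apply Rmult_le_compat_l with (r2 := 1 - t); [exact Hp|apply Rle_refl]].
    eapply Rle_trans;
      [|apply Rmult_le_compat_l with (r1 := rsum m (fun j => wt m j * Rabs (2 * z j - z m)));
        [exact Hp|lra]].
    rewrite <- rsum_scal. apply rsum_le. intros j Hj. unfold Rdiv.
    rewrite !Rabs_mult, (Rabs_right (/ 2)) by lra.
    pose proof (slope_bound j b Hj Hb). pose proof (Rabs_pos (2 * z j - z m)). nra. }
  assert (Hdot : gamma - dot (S m) a z =
    center_value - (z m - 1) * (rsum m a / 2 + a m) - X).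
  { unfold X, center_value, dot. simpl.
    rewrite (rsum_ext m (fun j => a j / 2 * (2 * z j - z m))
      (fun j => 1 * (a j * z j) + (- (z m / 2)) * a j)) by (intros; field).
    rewrite rsum_lin. field. }
  rewrite Hdot. clear Hdot.
  destruct (HX 0 (or_introl eq_refl)) as [A0 A1].
  destruct (HX 1 (or_intror eq_refl)) as [B0 B1].
  set (D := rsum m a / 2 + a m) in *.
  replace (gamma - 0 * (rsum m a + 2 * a m)) with (center_value + D) in *
    by (unfold center_value, D; field).
  replace (gamma - 1 * (rsum m a + 2 * a m)) with (center_value - D) in *
    by (unfold center_value, D; field).
  pose proof (Rle_abs X) as X1. pose proof (Rle_abs (- X)) as X2. rewrite Rabs_Ropp in X2.
  clearbody X D. clear HX. repeat split; [| |lra].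
  - destruct (Rle_dec 0 D); nra.
  - destruct (Rle_dec 0 D); nra.
Qed.

End NonnegativeAffine.

(** * The lattice points in the facets *)

(** The points are numbered for the pigeonhole principle; coordinates in [nat] make their
    integrality immediate. *)
Definition facet_pt (m v j : nat) : nat :=
  if v <? 2 ^ m then
    if j <? m then Nat.b2n (Nat.testbit v j) else if j =? m then 1 else 0
  else if v =? 2 ^ m then 0
  else if j <? m then 1 else if j =? m then 2 else 0.

Definition mid (m u v : nat) (t : R) (j : nat) : R :=
  if j =? S m then t else (INR (facet_pt m u j) + INR (facet_pt m v j)) / 2.

(** Two distinct eps differ in some coordinate j, where the midpoint has 2 x_j = s = 1; the
    vanishing term frees w_j >= 2^(-m). For all other pairs |2 x_j - s| <= 1/2 throughout, so the
    sum is at most 1/2. *)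
Lemma below_mid m u v t :
  (2 <= m)%nat -> (u < v)%nat -> (v < 2 ^ m + 2)%nat -> below m (mid m u v t) ((/2) ^ m).
Proof.
  intros Hm Huv Hv.
  assert (Hh : (/2) ^ m <= /2) by (rewrite <- (pow_1 (/2)) at 2; apply half_pow_le; lia).
  pose proof (half_pow_pos m) as Hp.
  assert (Em : mid m u v t m = (INR (facet_pt m u m) + INR (facet_pt m v m)) / 2).
  { unfold mid. now rewrite (proj2 (Nat.eqb_neq m (S m))) by lia. }
  assert (Ej : forall j, (j < m)%nat ->
    mid m u v t j = (INR (facet_pt m u j) + INR (facet_pt m v j)) / 2).
  { intros j Hj. unfold mid. now rewrite (proj2 (Nat.eqb_neq j (S m))) by lia. }
  assert (Hhalf : (forall j, (j < m)%nat ->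
      Rabs (2 * mid m u v t j - mid m u v t m) <= /2) ->
    rsum m (fun j => wt m j * Rabs (2 * mid m u v t j - mid m u v t m)) + (/2) ^ m <= 1).
  { intros H.
    assert (rsum m (fun j => wt m j * Rabs (2 * mid m u v t j - mid m u v t m))
            <= rsum m (fun j => /2 * wt m j)).
    { apply rsum_le. intros j Hj. specialize (H j Hj). pose proof (wt_pos m j). nra. }
    rewrite rsum_scal, wt_sum in H0 by lia. lra. }
  unfold facet_pt in Em, Ej. rewrite Nat.ltb_irrefl, Nat.eqb_refl in Em.
  destruct (Nat.ltb_spec u (2 ^ m)) as [Hu|Hu];
  destruct (Nat.ltb_spec v (2 ^ m)) as [Hv'|Hv']; try lia.
  - simpl in Em. repeat split; try lra.
    destruct (testbit_neq m u v) as (j0 & Hj0 & Hneq); try lia.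
    rewrite <- (wt_sum m) by lia. apply rsum_le_gap with (j := j0); [assumption| |].
    + intros j Hj. rewrite Em, Ej, (proj2 (Nat.ltb_lt j m)) by assumption.
      pose proof (wt_pos m j). rewrite <- (Rmult_1_r (wt m j)) at 2.
      apply Rmult_le_compat_l; [lra|]. apply Rabs_le.
      destruct (Nat.testbit u j), (Nat.testbit v j); simpl; lra.
    + rewrite Em, Ej, (proj2 (Nat.ltb_lt j0 m)) by assumption.
      pose proof (wt_ge m j0).
      match goal with |- _ * Rabs ?e + _ <= _ => replace e with 0 end.
      * rewrite Rabs_R0. lra.
      * destruct (Nat.testbit u j0), (Nat.testbit v j0); simpl; try lra; now elim Hneq.
  - destruct (Nat.eqb_spec v (2 ^ m)) as [Hv2|Hv2]; simpl in Em;
      (repeat split; [lra|lra|]); apply Hhalf; intros j Hj;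
      rewrite Em, Ej, (proj2 (Nat.ltb_lt j m)) by assumption; apply Rabs_le;
      destruct (Nat.testbit u j); simpl; lra.
  - rewrite (proj2 (Nat.eqb_eq u (2 ^ m))) in * by lia.
    rewrite (proj2 (Nat.eqb_neq v (2 ^ m))) in * by lia. simpl in Em.
    repeat split; [lra|lra|]; apply Hhalf; intros j Hj.
    rewrite Em, Ej, (proj2 (Nat.ltb_lt j m)) by assumption; apply Rabs_le; simpl; lra.
Qed.

Lemma supported_mid m u v t : supported (S (S m)) (mid m u v t).
Proof.
  intros j Hj. unfold mid, facet_pt. rewrite (proj2 (Nat.eqb_neq j (S m))) by lia.
  rewrite (proj2 (Nat.ltb_ge j m)), (proj2 (Nat.eqb_neq j m)) by lia.
  destruct (u <? 2 ^ m), (v <? 2 ^ m), (u =? 2 ^ m), (v =? 2 ^ m); simpl; lra.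
Qed.

Lemma mid_height m u v t : mid m u v t (S m) = t.
Proof. unfold mid. now rewrite Nat.eqb_refl. Qed.

Lemma dot_mid m u v t d :
  dot (S m) d (mid m u v t) =
  (dot (S m) d (fun j => INR (facet_pt m u j)) + dot (S m) d (fun j => INR (facet_pt m v j))) / 2.
Proof.
  unfold dot.
  rewrite (rsum_ext (S m) _ (fun j => /2 * (d j * INR (facet_pt m u j)) +
                                       /2 * (d j * INR (facet_pt m v j)))).
  - rewrite rsum_lin. field.
  - intros j Hj. unfold mid. rewrite (proj2 (Nat.eqb_neq j (S m))) by lia. field.
Qed.

(** Two of the lattice points share an inequality, and half-spaces are convex. The height [t] is
    arbitrary because the disjunction involves only the integer coordinates. *)
Lemma disjunction_misses_mid m d delta :
  k_disjunction (S m) (2 ^ m + 1) d delta ->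
  exists u v i, (u < v)%nat /\ (v < 2 ^ m + 2)%nat /\ (i < 2 ^ m + 1)%nat /\
    forall t, dot (S m) (d i) (mid m u v t) <= delta i.
Proof.
  intros (_ & _ & _ & H).
  destruct (pigeonhole (2 ^ m + 1)
    (fun v i => dot (S m) (d i) (fun j => INR (facet_pt m v j)) <= delta i))
    as (u & v & i & Huv & Hv & Hi & Hu' & Hv').
  { intros v _. apply H. intros j _. apply is_int_INR. }
  exists u, v, i. repeat split; [assumption|lia|assumption|].
  intros t. rewrite dot_mid. lra.
Qed.

(** * Iterated closures *)

Lemma cut_valid_int N p k C a gamma z :
  k_disj_cut N p k C a gamma -> C z -> (forall j, (j < p)%nat -> is_int (z j)) ->
  dot N a z <= gamma.
Proof.
  intros (_ & d & delta & (_ & _ & _ & Hd) & H) HC Hz.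
  apply Rnot_lt_le. intros Hlt.
  destruct (Hd z Hz) as (i & Hi & Hle).
  specialize (H z HC Hlt i Hi). lra.
Qed.

Lemma iter_int N p k P n z :
  P z -> (forall j, (j < p)%nat -> is_int (z j)) -> k_disj_iter N p k P n z.
Proof.
  intros HP Hz. induction n as [|n IH]; simpl; [assumption|].
  split; [assumption|]. intros a gamma Hcut.
  eapply cut_valid_int; eauto.
Qed.

(** One round costs the ratio of the two constants in [slack_bounds]: 2^(-m), at depth t = 2^(-m),
    against 2. *)
Definition height (m n : nat) : R := (/2) ^ m * ((/2) ^ m / 2) ^ n.

Lemma height_pos m n : 0 < height m n.
Proof.
  pose proof (half_pow_pos m). apply Rmult_lt_0_compat; [assumption|].
  apply pow_lt; lra.
Qed.

Lemma height_succ m n : height m (S n) = height m n * ((/2) ^ m / 2).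
Proof. unfold height. simpl. ring. Qed.

(** The required depth of the base point stays fixed while only the height shrinks, so the induction
    hypothesis applies to the midpoints as well as to z. *)
Lemma iter_deep m n z :
  (2 <= m)%nat -> supported (S (S m)) z -> below m z ((/2) ^ m) ->
  0 <= z (S m) <= height m n ->
  k_disj_iter (S (S m)) (S m) (2 ^ m + 1) (pyramid m) n z.
Proof.
  intros Hm. revert z.
  pose proof (half_pow_pos m) as Hp.
  assert (Hle : (/2) ^ m <= 1) by (rewrite <- (pow_O (/2)); apply half_pow_le; lia).
  induction n as [|n IH]; intros z Hz Hb Hy.
  - unfold height in Hy. simpl in Hy. destruct Hb as (B1 & B2 & B3).
    repeat split; try assumption; lra.
  - pose proof (height_pos m n) as Hn. rewrite height_succ in Hy.
    split; [apply IH; try assumption; nra|].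
    intros a gamma Hcut. apply Rnot_lt_le. intros Hlt.
    assert (Hsplit : forall x, dot (S (S m)) a x = dot (S m) a x + a (S m) * x (S m))
      by reflexivity.
    (* Lattice points with y = 0 lie in every iterate and satisfy every cut, so the cut restricted
       to y = 0 fits [slack_bounds]. *)
    assert (valid : forall x, pyramid m x -> (forall j, (j < S m)%nat -> is_int (x j)) ->
      x (S m) = 0 -> dot (S m) a x <= gamma).
    { intros x Hx Hi H0.
      pose proof (cut_valid_int _ _ _ _ _ _ x Hcut (iter_int _ _ _ _ n x Hx Hi) Hi) as H.
      rewrite Hsplit, H0 in H. lra. }
    pose proof (slack_bounds m a gamma Hm valid) as Hsl.
    destruct (Hsl z _ (Rlt_le _ _ Hp) Hb) as [[G1 _] G0].
    set (G := center_value m a gamma) in *.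
    rewrite Hsplit in Hlt.
    (* As z is cut off, a_y z_y exceeds its slack, which is at least 2^(-m) G. Passing from
       [height m (S n)] up to [height m n] gives more than 2 G, enough to cut off every midpoint. *)
    assert (HG : 2 * G < a (S m) * height m n).
    { assert (0 < a (S m)) by nra.
      assert ((/2) ^ m * G < a (S m) * (height m n * ((/2) ^ m / 2))) by nra.
      nra. }
    destruct Hcut as (_ & d & delta & Hd & Hout).
    destruct (disjunction_misses_mid m d delta Hd) as (u & v & i & Huv & Hv & Hi & Hdi).
    specialize (Hdi (height m n)). apply Rle_not_lt in Hdi. apply Hdi.
    pose proof (below_mid m u v (height m n) Hm Huv Hv) as Hbm.
    apply Hout; [| |assumption].
    + apply IH; [apply supported_mid|assumption|rewrite mid_height; lra].
    + rewrite Hsplit, mid_height.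
      destruct (Hsl _ _ (Rlt_le _ _ Hp) Hbm) as [[_ G2] _]. fold G in G2. lra.
Qed.

Definition last_unit (m j : nat) : R := if j =? S m then 1 else 0.

Lemma dot_last_unit m z : dot (S (S m)) (last_unit m) z = z (S m).
Proof.
  rewrite dot_split. unfold dot, last_unit.
  rewrite Nat.eqb_refl, (proj2 (Nat.eqb_neq m (S m))) by lia.
  rewrite (rsum_ext m _ (fun _ => 0)); [rewrite rsum_0; ring|].
  intros j Hj. rewrite (proj2 (Nat.eqb_neq j (S m))) by lia. ring.
Qed.

Lemma zero_in_hull m : (1 <= m)%nat -> integer_hull (S m) (pyramid m) (fun _ => 0).
Proof.
  intros Hm. exists 1%nat, (fun _ => 1), (fun _ _ => 0). repeat split; try (simpl; lra).
  - rewrite (rsum_ext m _ (fun _ => 0)); [rewrite rsum_0; lra|].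
    intros j _. replace (2 * 0 - 0) with 0 by ring. rewrite Rabs_R0. ring.
  - intros; apply (is_int_INR 0).
  - intros; simpl; lra.
Qed.

(** The condition y <= 0 passes from the integer points to their convex combinations. *)
Lemma hull_height m z :
  (1 <= m)%nat -> integer_hull (S m) (pyramid m) z -> z (S m) <= 0.
Proof.
  intros Hm (k & lam & pts & Hpts & _ & Hz). rewrite Hz, <- (rsum_0 k).
  apply rsum_le. intros i Hi. destruct (Hpts i Hi) as (Hl & HP & Hint).
  pose proof (pyramid_int_height m (pts i) Hm HP Hint). nra.
Qed.

Theorem theorem2p11 :
  forall p : nat, (3 <= p)%nat ->
  exists q : nat, (1 <= q)%nat /\
  exists P : (nat -> R) -> Prop,
    rational_polytope (p + q) P /\
    (exists z, integer_hull p P z) /\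
    exists w : nat -> R,
      (forall j, (j < p + q)%nat -> is_rat (w j)) /\
      exists gamma_star : R,
        (exists z, integer_hull p P z /\ dot (p + q) w z = gamma_star) /\
        (forall z, integer_hull p P z -> dot (p + q) w z <= gamma_star) /\
        (forall n : nat,
           exists z, k_disj_iter (p + q) p (Nat.pow 2 (p - 1) + 1) P n z /\
                     dot (p + q) w z > gamma_star).
Proof.
  (* The integer coordinates are the m = p - 1 entries of x together with s; the height y is the
     only continuous one. *)
  intros [|m] Hp; [lia|]. exists 1%nat. split; [lia|].
  replace (S m + 1)%nat with (S (S m)) by lia.
  replace (S m - 1)%nat with m by lia.
  assert (Hm : (2 <= m)%nat) by lia.
  exists (pyramid m). split; [apply pyramid_rational|].
  pose proof (zero_in_hull m ltac:(lia)) as H0.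
  split; [now exists (fun _ => 0)|].
  exists (last_unit m). split.
  { intros j _. unfold last_unit. destruct (j =? S m); apply is_rat_IZR. }
  exists 0. split; [|split].
  - exists (fun _ => 0). split; [assumption|apply dot_last_unit].
  - intros z Hz. rewrite dot_last_unit. apply hull_height; [lia|assumption].
  (* Any pair would do; [0] and [1] number two of the points (eps, 1). *)
  - intros n. exists (mid m 0 1 (height m n)).
    pose proof (height_pos m n).
    rewrite dot_last_unit, mid_height. split; [|assumption].
    apply iter_deep; [assumption|apply supported_mid|apply below_mid; lia|].
    rewrite mid_height. lra.
Qed.
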